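(* Let $t \in D$ and let $D^s \subset D$ be a scenario sub-domain. Then there is no $x \in D^s$ such that $\nabla_{D^s}(t,M) < \|x,t\| < \Delta_{D^s}(t,M)$.
   Context: $D$ is the input space (a set, discrete or continuous) of a machine learning model $M$, equipped with a distance metric $\|\cdot,\cdot\|: D\times D \to \mathbb{R}_{\ge 0}$. A scenario $s$ is represented by a subset $D^s \subset D$. For a fixed test case $t\in D$, $Fail^M_t(x)$ is a given predicate on $x \in D$ (''$M$ behaves differently on $x$ than on $t$ according to a test oracle''). Minimal distance to failure: $\Delta_{D^s}(t,M) = \min_{x\in D^s}\{\|x,t\| \mid Fail^M_t(x)\}$. Safe: for $x \in D^s$, $Safe^M_t(x)$ holds iff $\neg Fail^M_t(x)$ and for all $x'\in D^s$, $\|x',t\|<\|x,t\|$ implies $\neg Fail^M_t(x')$. Maximal safe distance: $\nabla_{D^s}(t,M) = \max_{x\in D^s}\{\|x,t\| \mid Safe^M_t(x)\}$. The minimum and the maximum are assumed to exist (be attained). *)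

(* Defs.v *)
From HB Require Import structures.
From mathcomp Require Import all_boot all_order all_algebra.
From mathcomp Require Import boolp classical_sets reals metric_structure.

Set Implicit Arguments.
Unset Strict Implicit.
Unset Printing Implicit Defensive.

Import Order.TTheory GRing.Theory Num.Theory.
Local Open Scope classical_set_scope.
Local Open Scope ring_scope.

Section Minimum_maximum.
Context {R : realType}.
Implicit Type A : set R.

Definition minima A : set R := A `&` lbound A.
Definition maxima A : set R := A `&` ubound A.

(* [minima A] and [maxima A] have at most one element. The default value 0 is
   returned when there is none, so a use of [set_min A] or [set_max A] must be
   accompanied by the hypothesis [minima A !=set0] or [maxima A !=set0]. *)
Definition set_min A : R := xget 0 (minima A).
Definition set_max A : R := xget 0 (maxima A).

End Minimum_maximum.

(* [Fail M t x] is the failure predicate: according to the test oracle, the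
   model [M] behaves differently on [x] than on the test case [t]. It is an
   arbitrary predicate. A scenario is the subset [Ds] of the input space [D]
   that represents it; it need not contain [t]. *)
Section Scenario.
Context {R : realType} {D : metricType R} {Model : Type}.
Variable Fail : Model -> D -> D -> Prop.
Implicit Types (Ds : set D) (t x : D) (M : Model).

(* Only meant for [x] in [Ds]. *)
Definition Safe Ds t M x : Prop :=
  ~ Fail M t x /\
  forall x', Ds x' -> mdist x' t < mdist x t -> ~ Fail M t x'.

Definition failure_distances Ds t M : set R :=
  [set mdist x t | x in [set x | Ds x /\ Fail M t x]].

Definition safe_distances Ds t M : set R :=
  [set mdist x t | x in [set x | Ds x /\ Safe Ds t M x]].

Definition minimal_distance_to_failure Ds t M : R :=
  set_min (failure_distances Ds t M).

Definition maximal_safe_distance Ds t M : R :=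
  set_max (safe_distances Ds t M).

End Scenario.

(* Main.v *)
Require Import Defs.
From HB Require Import structures.
From mathcomp Require Import all_boot all_order all_algebra.
From mathcomp Require Import boolp classical_sets reals metric_structure.

Set Implicit Arguments.
Unset Strict Implicit.
Unset Printing Implicit Defensive.

Import Order.TTheory GRing.Theory Num.Theory.
Local Open Scope classical_set_scope.
Local Open Scope ring_scope.

(** A point of [Ds] strictly closer to [t] than the nearest failure is safe, since neither it nor
    any closer point of [Ds] can fail ([safe_below_failures]). Its distance is then one of the safe
    distances, so it cannot exceed their maximum. *)

Lemma set_minP (R : realType) (A : set R) :
  minima A !=set0 -> minima A (set_min A).
Proof. by case=> m Am; exact: xgetI Am. Qed.

Lemma set_maxP (R : realType) (A : set R) :
  maxima A !=set0 -> maxima A (set_max A).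
Proof. by case=> m Am; exact: xgetI Am. Qed.

(** Both clauses of [Safe] come from one fact: a failure in [Ds] at distance below [d] would
    contradict the lower bound. It applies to [x], and by transitivity to every point closer than
    [x]. *)
Lemma safe_below_failures (R : realType) (D : metricType R) (Model : Type)
    (Fail : Model -> D -> D -> Prop) (M : Model) (t x : D) (Ds : set D) (d : R) :
  lbound (failure_distances Fail Ds t M) d ->
  Ds x -> mdist x t < d -> Safe Fail Ds t M x.
Proof.
move=> d_lb Dsx xd.
have no_fail y : Ds y -> mdist y t < d -> ~ Fail M t y.
  move=> Dsy yd Fy; have : d <= mdist y t by apply: d_lb; exists y.
  by rewrite leNgt yd.
split; first exact: no_fail.
by move=> y Dsy yx; apply: no_fail => //; exact: lt_trans xd.
Qed.

Theorem theorem1 (R : realType) (D : metricType R) (Model : Type)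
    (Fail : Model -> D -> D -> Prop) (M : Model) (t : D) (Ds : set D)
    (min_exists : minima (failure_distances Fail Ds t M) !=set0)
    (max_exists : maxima (safe_distances Fail Ds t M) !=set0) :
  ~ exists x : D,
      Ds x /\
      maximal_safe_distance Fail Ds t M < mdist x t
        < minimal_distance_to_failure Fail Ds t M.
Proof.
move=> [x [Dsx /andP[x_gt x_lt]]].
(* Attainment rules out the default value 0, so the two distances really bound their sets. *)
have [_ min_lb] := set_minP min_exists.
have [_ max_ub] := set_maxP max_exists.
have safe_x := safe_below_failures min_lb Dsx x_lt.
have : mdist x t <= maximal_safe_distance Fail Ds t M.
  by apply: max_ub; exists x.
by rewrite leNgt x_gt.
Qed.
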